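(* Let $\mathbb{F}$ be a field of characteristic zero and let $W(2)$ be the conservative algebra over $\mathbb{F}$ of all multiplications on a $2$-dimensional vector space. Then every local derivation $\nabla : W(2)\to W(2)$ is a derivation.
   Context: Let $V_2$ be a $2$-dimensional vector space over $\mathbb{F}$ with a basis $v_1,v_2$. The algebra $W(2)$ is the $8$-dimensional vector space of all multiplications on $V_2$, i.e. all bilinear maps $V_2\times V_2\to V_2$, with the (nonassociative) product $$(A\cdot B)(x,y)=A(v_1,B(x,y))-B(A(v_1,x),y)-B(x,A(v_1,y)),\qquad x,y\in V_2,\ A,B\in W(2).$$ For a (not necessarily associative) $\mathbb{F}$-algebra $\mathcal{A}$: a linear map $D:\mathcal{A}\to\mathcal{A}$ is a derivation if $D(xy)=D(x)y+xD(y)$ for all $x,y\in\mathcal{A}$. A linear map $\nabla:\mathcal{A}\to\mathcal{A}$ is a local derivation if for every $x\in\mathcal{A}$ there exists a derivation $D_x:\mathcal{A}\to\mathcal{A}$ (depending on $x$) such that $\nabla(x)=D_x(x)$. *)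

(* Defs.v *)
From HB Require Import structures.
From mathcomp Require Import all_boot all_order all_algebra.

Set Implicit Arguments.
Unset Strict Implicit.
Unset Printing Implicit Defensive.

Import GRing.Theory.
Local Open Scope ring_scope.

(* A nonassociative algebra is a module [A] together with a product           *)
(* [mul : A -> A -> A]; MathComp's ring structures all require associativity. *)
Section Derivations.

Variables (F : fieldType) (A : lmodType F) (mul : A -> A -> A).

Definition is_derivation (D : {linear A -> A}) : Prop :=
  forall x y : A, D (mul x y) = mul (D x) y + mul x (D y).

Definition is_local_derivation (N : {linear A -> A}) : Prop :=
  forall x : A, exists D : {linear A -> A}, is_derivation D /\ N x = D x.

End Derivations.

(* Bilinear maps V * V -> V in curried form: [A x y] is the value at (x, y). *)
Notation multiplications V := 'Hom(V, 'End(V)).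

Section Multiplications.

Variables (F : fieldType) (V : vectType F).
Implicit Types A B : multiplications V.

(* Meaningful only for bilinear [f], see [to_multE]: [linfun] returns an        *)
(* unrelated linear map on nonlinear input.                                   *)
Definition to_mult (f : V -> V -> V) : multiplications V :=
  linfun (fun x => linfun (f x)).

Lemma to_multE (f : V -> V -> V) :
  bilinear_for *:%R *:%R f -> forall x y, to_mult f x y = f x y.
Proof.
case=> fl fr x y.
have Lr u : linear (f u) by move=> a p q; exact: fr.
have frE u v : linfun (f u) v = f u v.
  pose m := GRing.isLinear.Build F V V *:%R (f u) (Lr u).
  pose g : {linear V -> V} := HB.pack (f u) m.
  exact: (lfunE g v).
have Ll : linear (fun x => linfun (f x)).
  move=> a p q; apply/lfunP => v.
  by rewrite add_lfunE scale_lfunE !frE; exact: (fl v a p q).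
pose m := GRing.isLinear.Build F V 'End(V) *:%R (fun x => linfun (f x)) Ll.
pose g : {linear V -> 'End(V)} := HB.pack (fun x => linfun (f x)) m.
by rewrite /to_mult (lfunE g x) /= frE.
Qed.

(* The product of the conservative algebra W(n), n = \dim V, where [v1] is the *)
(* first vector of the chosen basis; [WmulE] gives its values.                *)
Definition Wmul (v1 : V) A B : multiplications V :=
  to_mult (fun x y => A v1 (B x y) - B (A v1 x) y - B x (A v1 y)).

Lemma WmulE (v1 : V) A B x y :
  Wmul v1 A B x y = A v1 (B x y) - B (A v1 x) y - B x (A v1 y).
Proof.
rewrite /Wmul to_multE //; split=> [v|u] a p q /=.
  rewrite !linearP /= !(add_lfunE, scale_lfunE) !linearP /=.
  by rewrite [X in X + _ = _]addrACA [LHS]addrACA -!scalerDr.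
by rewrite !linearP /= [X in X + _ = _]addrACA [LHS]addrACA -!scalerDr.
Qed.

End Multiplications.

(* Main.v *)
Require Import Defs.
From mathcomp Require Import all_boot all_order all_algebra.
From mathcomp Require Import ring.
From HB Require Import structures.

Import GRing.Theory.
Local Open Scope ring_scope.

(* A . B is the natural action of the endomorphism A(v1, -) on B. This action *)
(* of gl(V) is faithful, so a derivation D induces a Lie derivation of gl(V) *)
(* through A |-> A(v1, -); computing it shows that D is the action of some T *)
(* with T v1 = 0. Such a T is determined by T v2, the value at (v1, v1) of *)
(* T . M for the multiplication M with M(v1, v1) = v2 and zero elsewhere. *)
(* Subtracting from a local derivation N the T that serves for M, one may *)
(* assume N M = 0; comparing N (M + B) and N B at (v1, v1) then gives N B = 0 *)
(* whenever B(v1, v1) is a multiple of v1, hence for all B by linearity. *)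

(** Two facts carry the argument. By [derivationE], every derivation is [act T] with [T v1 = 0]: by
    [induced_lie] and [induced_stab] the induced map on gl(V) is a Lie derivation preserving the
    stabilizer of [v1], and once its value on the map [v1] to [v2], [v2] to 0 kills [v1],
    commutators force it, and then D, to vanish. In [local_derivation_derivation], adding M to B
    ties the unknown T at [M + B] to the one at B. *)

Section TwoDimensional.

Set Implicit Arguments.
Unset Strict Implicit.

Variables (F : fieldType) (V : vectType F) (v1 v2 : V).
Hypothesis basisV : basis_of {:V} [:: v1; v2].

Let basis2 : 2.-tuple V := [tuple v1; v2].
Let i1 : 'I_2 := lift ord0 ord0.
Let c1 : {scalar V} := coord basis2 ord0.
Let c2 : {scalar V} := coord basis2 i1.

Let free2 : free basis2.
Proof. exact: basis_free basisV. Qed.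

Let coord_basis : (c1 v1 = 1) * (c1 v2 = 0) * (c2 v1 = 0) * (c2 v2 = 1).
Proof.
split; [split; [split |] |].
- exact: (coord_free 0 0 free2).
- exact: (coord_free i1 0 free2).
- exact: (coord_free 0 i1 free2).
- exact: (coord_free i1 i1 free2).
Qed.

Let coordK x : c1 x *: v1 + c2 x *: v2 = x.
Proof.
have /coord_span : x \in <<basis2>>%VS by rewrite (span_basis basisV) memvf.
by rewrite !big_ord_recl big_ord0 addr0 => /esym.
Qed.

Let coordP u v : c1 u = c1 v -> c2 u = c2 v -> u = v.
Proof. by move=> e1 e2; rewrite -(coordK u) -(coordK v) e1 e2. Qed.

Definition hom2 (W : vectType F) (p q : W) : 'Hom(V, W) :=
  linfun (fun x => c1 x *: p + c2 x *: q).

Lemma hom2E (W : vectType F) (p q : W) x :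
  hom2 p q x = c1 x *: p + c2 x *: q.
Proof.
have lin : linear (fun x => c1 x *: p + c2 x *: q).
  move=> a u v; rewrite (linearP c1) (linearP c2) /=.
  by rewrite !scalerDl scalerDr !scalerA addrACA.
pose m := GRing.isLinear.Build F V W *:%R _ lin.
pose g : {linear V -> W} := HB.pack (fun x => c1 x *: p + c2 x *: q) m.
exact: (lfunE g x).
Qed.

Lemma hom2_v1 (W : vectType F) (p q : W) : hom2 p q v1 = p.
Proof. by rewrite hom2E !coord_basis scale1r scale0r addr0. Qed.

Lemma hom2_v2 (W : vectType F) (p q : W) : hom2 p q v2 = q.
Proof. by rewrite hom2E !coord_basis scale1r scale0r add0r. Qed.

Lemma hom_basisP (W : vectType F) (f g : 'Hom(V, W)) :
  f v1 = g v1 -> f v2 = g v2 -> f = g.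
Proof.
move=> e1 e2; apply/lfunP => x.
by rewrite -(coordK x) !linearP /= !linearZ /= e1 e2.
Qed.

(** * The action of gl(V) on multiplications *)

Implicit Types (S T : 'End(V)) (A B : multiplications V).

Definition act T B : multiplications V :=
  to_mult (fun x y => T (B x y) - B (T x) y - B x (T y)).

Lemma WmulEact A B : Wmul v1 A B = act (A v1) B.
Proof. by []. Qed.

Lemma actE T B x y : act T B x y = T (B x y) - B (T x) y - B x (T y).
Proof.
(* [act T] is left multiplication by [hom2 T 0], whose value at [v1] is T. *)
by rewrite -{1}(hom2_v1 T 0) -WmulEact WmulE hom2_v1.
Qed.

Lemma multP A B : (forall x y, A x y = B x y) -> A = B.
Proof. by move=> e; apply/lfunP => x; apply/lfunP => y. Qed.

Definition lie S T : 'End(V) := (S \o T)%VF - (T \o S)%VF.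

Lemma lieE S T x : lie S T x = S (T x) - T (S x).
Proof. by rewrite add_lfunE opp_lfunE !comp_lfunE. Qed.

Let homD (W : vectType F) (f : 'Hom(V, W)) x y : f (x + y) = f x + f y.
Proof. exact: linearD. Qed.

Let homN (W : vectType F) (f : 'Hom(V, W)) x : f (- x) = - f x.
Proof. exact: linearN. Qed.

Ltac coordinates := apply: coordP;
  rewrite ?(linearD c1, linearN c1, linearD c2, linearN c2,
            linearZ_LR c1, linearZ_LR c2) /=;
  ring.

Ltac pointwise := apply: multP => ? ?;
  rewrite ?(actE, lieE, add_lfunE, opp_lfunE, homD, homN); coordinates.

Lemma act_linear T : linear (act T).
Proof.
move=> a A B; apply: multP => x y.
by rewrite !(actE, add_lfunE, scale_lfunE) (linearP T) /=; coordinates.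
Qed.

Lemma actDl S T B : act (S + T) B = act S B + act T B.
Proof. pointwise. Qed.

Lemma actNl T B : act (- T) B = - act T B.
Proof. pointwise. Qed.

Lemma act_lie S T B : act (lie S T) B = act S (act T B) - act T (act S B).
Proof. pointwise. Qed.

Let scale_v1 a : a *: v1 = 0 -> a = 0.
Proof.
move=> av1; rewrite -[a]mulr1 -(coord_basis.1.1.1) -(linearZ_LR c1) av1.
by rewrite linear0.
Qed.

(** Two tests suffice: the A for which [A x] is a coordinate of x times the identity. *)
Lemma hom_sep x : (forall A, A x = 0) -> x = 0.
Proof.
move=> Ax0; apply: coordP; rewrite linear0; apply: scale_v1.
  have /lfunP/(_ v1) := Ax0 (hom2 \1%VF 0).
  by rewrite hom2E scaler0 addr0 scale_lfunE id_lfunE zero_lfunE.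
have /lfunP/(_ v1) := Ax0 (hom2 0 \1%VF).
by rewrite hom2E scaler0 add0r scale_lfunE id_lfunE zero_lfunE.
Qed.

(* Tested on [B x y = l x *: y] with [l] a coordinate form, [act T B] takes *)
(* the value [- l (T x) *: y].                                                *)
Lemma act_faithful T : (forall B, act T B = 0) -> T = 0.
Proof.
move=> actT0; apply/lfunP => x; rewrite zero_lfunE.
have test p q :
    (hom2 (p *: \1%VF) (q *: \1%VF) : multiplications V) (T x) v1 = 0.
  have /lfunP/(_ x)/lfunP/(_ v1) := actT0 (hom2 (p *: \1%VF) (q *: \1%VF)).
  rewrite actE !hom2E !zero_lfunE !(add_lfunE, scale_lfunE) !id_lfunE.
  rewrite homD !(linearZ_LR T) /= addrAC subrr sub0r => /eqP.
  by rewrite oppr_eq0 => /eqP.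
apply: coordP; rewrite linear0; apply: scale_v1.
  have := test 1 0.
  by rewrite hom2E scale1r scale0r scaler0 addr0 scale_lfunE id_lfunE.
have := test 0 1.
by rewrite hom2E scale1r scale0r scaler0 add0r scale_lfunE id_lfunE.
Qed.

Lemma act_inj S T : (forall B, act S B = act T B) -> S = T.
Proof.
move=> eST; apply/eqP; rewrite -subr_eq0; apply/eqP/act_faithful => B.
by rewrite actDl actNl eST subrr.
Qed.

Lemma act0l B : act 0 B = 0.
Proof. by rewrite -(subrr 0) actDl actNl subrr. Qed.

Lemma act1l B : act \1%VF B = - B.
Proof.
apply: multP => x y; rewrite actE !id_lfunE !opp_lfunE.
by rewrite subrr sub0r.
Qed.

HB.instance Definition _ T :=
  GRing.isLinear.Build F (multiplications V) (multiplications V) *:%R (act T)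
    (act_linear T).

Local Notation endo_mult := {linear multiplications V -> multiplications V}.
Implicit Types D N : endo_mult.

Lemma derivation_sub D N :
  is_derivation (Wmul v1) D -> is_derivation (Wmul v1) N ->
  is_derivation (Wmul v1) (D \- N).
Proof.
move=> derD derN A B; rewrite /= derD derN !WmulEact.
rewrite add_lfunE opp_lfunE actDl actNl (linearB (act (A v1))) /=.
by rewrite opprD addrACA.
Qed.

(** When T kills [v1], [act T A] takes the value [lie T (A v1)] at [v1], so the Leibniz rule is
    [act_lie]. *)
Lemma act_derivation T : T v1 = 0 -> is_derivation (Wmul v1) (act T).
Proof.
move=> Tv1 A B; rewrite !WmulEact.
have -> : act T A v1 = lie T (A v1).
  by apply/lfunP => y; rewrite actE Tv1 linear0 zero_lfunE subr0 lieE.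
by rewrite act_lie subrK.
Qed.

(** The value 0 at [v2] is an arbitrary choice: for a derivation, [derivation_v1] shows that only
    the value at [v1] matters. *)
Definition induced D T : 'End(V) := D (hom2 T 0) v1.

Section OneDerivation.

Variable D : endo_mult.
Hypothesis derD : is_derivation (Wmul v1) D.

Local Notation d := (induced D).

Lemma derivation_act T B : D (act T B) = act (d T) B + act T (D B).
Proof. by have := derD (hom2 T 0) B; rewrite !WmulEact hom2_v1. Qed.

Lemma derivation_v1 A : D A v1 = d (A v1).
Proof.
suff: (D A - D (hom2 (A v1) 0)) v1 = 0.
  by rewrite add_lfunE opp_lfunE => /eqP; rewrite subr_eq0 => /eqP.
rewrite -linearB; set C := A - _.
have C0 : C v1 = 0 by rewrite /C add_lfunE opp_lfunE hom2_v1 subrr.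
(* C multiplies everything to 0 from the left, hence so does [D C]. *)
apply: act_faithful => B; have := derD C B; rewrite !WmulEact C0 !act0l addr0.
by rewrite linear0.
Qed.

Lemma inducedD S T : d (S + T) = d S + d T.
Proof.
have <- : (hom2 S 0 + hom2 T 0) v1 = S + T by rewrite add_lfunE !hom2_v1.
by rewrite -derivation_v1 linearD add_lfunE.
Qed.

Lemma inducedZ a T : d (a *: T) = a *: d T.
Proof.
have <- : (a *: hom2 T 0) v1 = a *: T by rewrite scale_lfunE !hom2_v1.
by rewrite -derivation_v1 linearZ_LR scale_lfunE.
Qed.

Lemma induced_lie S T : d (lie S T) = lie (d S) T + lie S (d T).
Proof.
apply: act_inj => B; rewrite actDl !act_lie.
have := derivation_act (lie S T) B; rewrite !act_lie linearB /= !derivation_act.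
rewrite !(linearD (act _)) /=.
set a := act (d (lie _ _)) _; set b := act (d S) _; set c := act S _.
set e := act S _; set f := act (d T) _; set g := act T _; set h := act T _.
move/eqP; rewrite -subr_eq => /eqP <-.
by move: a b c e f g h => *; pointwise.
Qed.

Lemma induced1 : d \1%VF = 0.
Proof.
apply: act_faithful => B; have := derivation_act \1%VF B.
by rewrite !act1l linearN => /eqP; rewrite -subr_eq subrr => /eqP.
Qed.

(** Computing [D (act T A) v1] by [derivation_act] and by [derivation_v1] gives results that differ
    only by [A (d T v1)]. *)
Lemma induced_stab T : T v1 = 0 -> d T v1 = 0.
Proof.
move=> Tv1; apply: hom_sep => A.
have act_v1 S C : act S C v1 = lie S (C v1) - C (S v1).
  by apply/lfunP => y; rewrite actE add_lfunE opp_lfunE lieE addrAC.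
have := derivation_v1 (act T A).
rewrite derivation_act add_lfunE !act_v1 Tv1 !linear0 !addr0 induced_lie.
rewrite derivation_v1 addrAC => /eqP.
by rewrite -[X in _ == X]addr0 (inj_eq (addrI _)) oppr_eq0 => /eqP.
Qed.

(** * Derivations with normalized induced map *)

Hypothesis two_neq0 : 2%:R != 0 :> F.
Local Notation J := (hom2 v2 0 : 'End(V)).
Hypothesis normD : d J v1 = 0.

Let decompose T :
  T = c1 (T v1) *: \1%VF + c2 (T v1) *: J + hom2 0 (T v2 - c1 (T v1) *: v2).
Proof.
apply: hom_basisP; rewrite !(add_lfunE, scale_lfunE) id_lfunE ?hom2_v1 ?hom2_v2.
  by rewrite addr0 coordK.
by rewrite scaler0 addr0 addrC subrK.
Qed.

Let induced_v1 T : d T v1 = 0.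
Proof.
rewrite [T]decompose !inducedD !inducedZ induced1 !(add_lfunE, scale_lfunE).
by rewrite normD zero_lfunE !scaler0 !add0r induced_stab // hom2_v1.
Qed.

Let induced_stab0 T : T v1 = 0 -> d T = 0.
Proof.
move=> Tv1; apply/lfunP => u; rewrite zero_lfunE.
(* At [v1], the Leibniz expansion of this commutator leaves only [d T u]. *)
have := induced_v1 (lie T (hom2 u 0)).
rewrite induced_lie add_lfunE !lieE !induced_v1 Tv1 !linear0 hom2_v1.
by rewrite !addr0.
Qed.

(* [J = [H, J]] for [H] the projection onto [v2] along [v1], and [d H = 0], so *)
(* [d J] lies in the eigenspace of [ad H] for the eigenvalue 1.               *)
Let induced_J : d J = 0.
Proof.
pose H : 'End(V) := hom2 0 v2.
have Hv1 : H v1 = 0 by exact: hom2_v1.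
have Hv2 : H v2 = v2 by exact: hom2_v2.
have lieHJ : lie H J = J.
  apply: hom_basisP; rewrite lieE ?Hv1 ?Hv2 ?hom2_v1 ?hom2_v2 ?Hv2 linear0;
    by rewrite subr0.
have dJ : d J = lie H (d J).
  rewrite -{1}lieHJ induced_lie (induced_stab0 Hv1).
  by apply/lfunP => x; rewrite add_lfunE lieE !zero_lfunE linear0 subr0 add0r.
apply: hom_basisP; rewrite zero_lfunE ?induced_v1 //.
have := congr1 (fun T : 'End(V) => T v2) dJ.
rewrite /= lieE hom2_v2 hom2E scaler0 add0r; set c := d J v2 => e.
apply: coordP; rewrite linear0.
  (* The equation reads [c = c2 c *: v2 - c], so [c1 c] equals its own opposite. *)
  move/(congr1 c1): (e); rewrite linearB linearZ_LR /= !coord_basis mulr0 sub0r.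
  move/eqP; rewrite -subr_eq0 opprK -mulr2n -mulr_natl mulf_eq0.
  by rewrite (negPf two_neq0) => /eqP.
by move/(congr1 c2): e; rewrite linearB linearZ_LR /= !coord_basis mulr1 subrr.
Qed.

Let induced0 T : d T = 0.
Proof.
rewrite [T]decompose !inducedD !inducedZ induced1 induced_J !scaler0 !add0r.
by rewrite induced_stab0 // hom2_v1.
Qed.

Lemma normalized_derivation0 A : D A = 0.
Proof.
apply/lfunP => u; rewrite zero_lfunE.
(* Since [d = 0], [D A] vanishes at [v1], and so does [act (hom2 u 0) (D A)], whose value there is
   [- D A u]. *)
have := derivation_v1 (act (hom2 u 0) A).
rewrite induced0 derivation_act induced0 act0l add0r => /lfunP DA.
apply/lfunP => y; have := DA y.
rewrite actE derivation_v1 induced0 !zero_lfunE linear0 hom2_v1 subr0 sub0r.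
by move/eqP; rewrite oppr_eq0 => /eqP.
Qed.

End OneDerivation.

Lemma derivationE D : 2%:R != 0 :> F -> is_derivation (Wmul v1) D ->
  exists2 T : 'End(V), T v1 = 0 & forall A, D A = act T A.
Proof.
(* [act T] induces [lie T], and [lie T (hom2 v2 0)] sends [v1] to [T v2]; this choice of [T v2]
   normalizes [D \- act T]. *)
move=> two_neq0 derD; pose T : 'End(V) := hom2 0 (induced D (hom2 v2 0) v1).
have Tv1 : T v1 = 0 by rewrite hom2_v1.
exists T => // A; apply/eqP; rewrite -subr_eq0; apply/eqP.
apply: (normalized_derivation0 (D := D \- act T)) => //.
  exact: derivation_sub derD (act_derivation Tv1).
rewrite /induced /= !(add_lfunE, opp_lfunE) actE Tv1 !hom2_v1 !linear0.
by rewrite zero_lfunE !subr0 !addr0 hom2_v2 -/(induced D _) subrr.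
Qed.

Lemma local_derivation_derivation N : 2%:R != 0 :> F ->
  is_local_derivation (Wmul v1) N -> is_derivation (Wmul v1) N.
Proof.
move=> two_neq0 locN.
have {}locN A : exists2 T : 'End(V), T v1 = 0 & N A = act T A.
  have [D [derD ->]] := locN A.
  by have [T Tv1 DE] := derivationE two_neq0 derD; exists T.
pose M : multiplications V := hom2 (hom2 v2 0) 0.
have Mv : M v1 v1 = v2 by rewrite !hom2_v1.
have [T0 T0v1 NM] := locN M.
pose n : endo_mult := N \- act T0.
have nM : n M = 0 by rewrite /n /= NM subrr.
have locn A : exists2 T : 'End(V), T v1 = 0 & n A = act T A.
  have [T Tv1 NA] := locN A; exists (T - T0).
    by rewrite add_lfunE opp_lfunE Tv1 T0v1 subrr.
  by rewrite /n /= NA actDl actNl.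
have act_v1v1 T A : T v1 = 0 -> act T A v1 v1 = T (A v1 v1).
  by move=> Tv1; rewrite actE Tv1 !linear0 zero_lfunE !subr0 ?addr0.
(* [n (M + B) = n B]; comparing both sides at [(v1, v1)] kills [T' v2].      *)
have n0 B : c2 (B v1 v1) = 0 -> n B = 0.
  move=> c2B; have [T' T'v1 nMB] := locn (M + B); have [T Tv1 nB] := locn B.
  have Bv : B v1 v1 = c1 (B v1 v1) *: v1.
    by rewrite -{1}[B v1 v1]coordK c2B scale0r addr0.
  have eB : n B = act T' (M + B) by rewrite -nMB linearD nM add0r.
  have T'v2 : T' v2 = 0.
    have := congr1 (fun A : multiplications V => A v1 v1) eB.
    rewrite nB /= !act_v1v1 // !add_lfunE Mv Bv homD !linearZ_LR /=.
    by rewrite Tv1 T'v1 scaler0 addr0.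
  have -> : n B = act 0 (M + B).
    by rewrite eB; congr act; apply: hom_basisP; rewrite zero_lfunE.
  exact: act0l.
have NE A : N A = act T0 A.
  apply/eqP; rewrite -subr_eq0; apply/eqP; change (n A = 0).
  (* Subtracting this multiple of M puts A in the scope of [n0], and [n M = 0]. *)
  rewrite -[A](subrK (c2 (A v1 v1) *: M)) (linearD n) (linearZ_LR n).
  rewrite nM scaler0 addr0.
  apply: n0; rewrite !(add_lfunE, opp_lfunE, scale_lfunE) Mv.
  by rewrite linearB linearZ_LR /= !coord_basis mulr1 subrr.
by move=> A B; rewrite !NE; apply: act_derivation.
Qed.

End TwoDimensional.

Theorem theorem3p1 (F : fieldType) (charF0 : [pchar F] =i pred0)
    (V : vectType F) (v1 v2 : V) (basisV : basis_of {:V} [:: v1; v2])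
    (nabla : {linear multiplications V -> multiplications V}) :
  is_local_derivation (Wmul v1) nabla -> is_derivation (Wmul v1) nabla.
Proof.
apply: (local_derivation_derivation basisV).
by have := charF0 2; rewrite !inE /= => ->.
Qed.
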